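(* Let $z_\alpha$, for $\alpha$ ranging over all compositions of all $n\ge1$, be commuting indeterminates. Let $I\subseteq\mathbb{Q}[z_\alpha]$ be the ideal generated by: - $z_\alpha z_\beta-z_{\alpha\cdot\beta}-z_{\alpha\odot\beta}$ for all compositions $\alpha,\beta$; - the even transpose forms $\xi_{2m}=z_{2m}-z_{1^{2m}}$ for $m\ge1$, where $1^{2m}$ is the composition with $2m$ parts all equal to $1$. Then the algebra homomorphism $\mathbb{Q}[z_\alpha]\to\mathbb{Q}\otimes_{\mathbb{Z}}\Omega$, $z_\alpha\mapsto\mathfrak{r}_\alpha$, induces an isomorphism $\mathbb{Q}[z_\alpha]/I\cong\mathbb{Q}\otimes\Omega$. Thus all relations amongst ribbon Schur $Q$-functions are generated by $\mathfrak{r}_\alpha\mathfrak{r}_\beta=\mathfrak{r}_{\alpha\cdot\beta}+\mathfrak{r}_{\alpha\odot\beta}$ and $\mathfrak{r}_{2m}=\mathfrak{r}_{1^{2m}}$ for $m\ge1$.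
   Context: A composition $\alpha=\alpha_1\cdots\alpha_k$ is a finite sequence of positive integers. For compositions $\alpha=\alpha_1\cdots\alpha_k$ and $\beta=\beta_1\cdots\beta_l$, define $$\alpha\cdot\beta=\alpha_1\cdots\alpha_k\beta_1\cdots\beta_l,\qquad \alpha\odot\beta=\alpha_1\cdots\alpha_{k-1}(\alpha_k+\beta_1)\beta_2\cdots\beta_l.$$ A ribbon is a connected skew diagram (English convention) with no $2\times2$ block, and the ribbon $\alpha$ has $\alpha_i$ cells in its $i$-th row from the top. Set $q_0=1$ and $q_n=0$ for $n<0$. Here $q_n=Q_{(n)}$ is the single-row skew Schur $Q$-function: the sum over weakly increasing fillings of a row of $n$ cells by $1'<1<2'<2<\cdots$ using each primed letter at most once, of $\prod_i x_i^{(\#i+\#i')}$. Put $\Omega=\mathbb{Z}[q_1,q_2,\ldots]$. For a ribbon $\alpha=\nu/\kappa$, the ribbon Schur $Q$-function is $\mathfrak{r}_\alpha=\det(q_{\nu_i-\kappa_j-i+j})_{i,j=1}^{\ell(\nu)}$. *)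

(* Defs.v *)
From HB Require Import structures.
From mathcomp Require Import all_boot all_order all_algebra ring_quotient.
From mathcomp Require Import finmap boolp monalg.

Set Implicit Arguments.
Unset Strict Implicit.
Unset Printing Implicit Defensive.

Import GRing.Theory Num.Theory.

Local Open Scope ring_scope.

Section MonomialDivisors.
Variable I : choiceType.
Implicit Types m d e : {cmonom I}.

Definition cmonom_ffun m (f : {ffun finsupp m -> 'I_(mdeg m).+1}) : {cmonom I} :=
  [cmonom nat_of_ord (f i) | i : finsupp m]%M.

(* The monomials dividing m: exponents of a divisor are bounded by mdeg m. *)
Definition cmdivs m : {fset {cmonom I}} :=
  [fset d in [fset cmonom_ffun f | f in {: {ffun finsupp m -> 'I_(mdeg m).+1}}]
   | [forall i : finsupp m, d (val i) <= m (val i)]%N]%fset.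

Lemma cmdivsP m d : reflect (forall i, d i <= m i)%N (d \in cmdivs m).
Proof.
apply: (iffP idP) => [|le_dm].
  rewrite !inE => /andP[/= /imfsetP[/= f _ ->] /forallP le_dm] i.
  case: (finsuppP m i) => [mi|mi]; last exact: (le_dm [` mi]%fset).
  by rewrite cmE fsfun_ffun insubF //; apply/negbTE.
rewrite !inE /=; apply/andP; split; last by apply/forallP.
have bnd (i : finsupp m) : (d (val i) < (mdeg m).+1)%N.
  rewrite ltnS (leq_trans (le_dm _)) // mdegE (big_fsetD1 (val i)) ?fsvalP //=.
  by rewrite leq_addr.
apply/imfsetP; exists [ffun i => Ordinal (bnd i)] => //.
apply/eqP/cmP => i; rewrite cmE fsfun_ffun.
case: insubP => [j _ <-|mi] /=; first by rewrite ffunE.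
by apply/eqP; rewrite -leqn0 (leq_trans (le_dm i)) // fsfun_dflt.
Qed.

Lemma cmdivs_refl m : m \in cmdivs m. Proof. exact/cmdivsP. Qed.

Lemma cmdivsM d e : d \in cmdivs (mmul d e).
Proof. by apply/cmdivsP => i; rewrite cmM leq_addr. Qed.

Lemma mul_cmdivs m d : d \in cmdivs m -> mmul d (divcm m d) = m.
Proof.
by move=> /cmdivsP le_dm; apply/eqP/cmP => i; rewrite cmM divcmE subnKC.
Qed.

Lemma divcmM d e : divcm (mmul d e) d = e.
Proof. by apply/eqP/cmP => i; rewrite divcmE cmM addKn. Qed.

Lemma divcm_cmdivs m d : divcm m d \in cmdivs m.
Proof. by apply/cmdivsP => i; rewrite divcmE leq_subr. Qed.

Lemma cmdivs_trans m d e : d \in cmdivs m -> e \in cmdivs d -> e \in cmdivs m.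
Proof.
move=> /cmdivsP le_dm /cmdivsP le_ed.
by apply/cmdivsP => i; apply: leq_trans (le_dm i).
Qed.

Lemma mcoeffM_divs (R : comNzRingType) (a b : {malg R[{cmonom I}]}) m :
  (a * b)@_m = \sum_(d <- cmdivs m) a@_d * b@_(divcm m d).
Proof.
pose F d := if d \in cmdivs m then a@_d * b@_(divcm m d) else 0.
have -> : (a * b)@_m = \sum_(d <- msupp a) F d.
  rewrite mcoeffMl; apply: eq_bigr => d _; rewrite /F.
  have [d_m|d_m] := boolP (d \in cmdivs m); last first.
    rewrite big1 // => e _; case: eqP => [def_m|]; last by rewrite mulr0n.
    by rewrite -def_m cmdivsM in d_m.
  have eq_e e : (mmul d e == m) = (e == divcm m d).
    by apply/eqP/eqP => [<-|->]; [rewrite divcmM | rewrite mul_cmdivs].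
  under eq_bigr => e _ do rewrite eq_e.
  have [b_e|b_e] := boolP (divcm m d \in msupp b).
    rewrite (big_fsetD1 _ b_e) /= eqxx mulr1n big1_fset ?addr0 // => e.
    by rewrite !inE => /andP[/negbTE-> _]; rewrite mulr0n.
  rewrite (mcoeff_outdom b_e) mulr0 big1_fset // => e e_b _.
  by case: eqP => // def_e; rewrite def_e (negbTE b_e) in e_b.
pose A := (msupp a `|` cmdivs m)%fset.
transitivity (\sum_(d <- A) F d).
  apply: big_fset_incl; first exact: fsubsetUl.
  by move=> d _ d_a; rewrite /F mcoeff_outdom // mul0r if_same.
rewrite -(@big_fset_incl _ _ _ _ (cmdivs m)) ?fsubsetUr //; last first.
  by move=> d _ /negbTE d_m; rewrite /F d_m.
by rewrite big_seq [RHS]big_seq; apply: eq_bigr => d d_m; rewrite /F d_m.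
Qed.
End MonomialDivisors.

(* Formal power series in commuting variables indexed by I: families of       *)
(* coefficients, with the Cauchy product.                                     *)
Record pseries (I : choiceType) (R : comNzRingType) : Type :=
  PSeries { pscoef :> {cmonom I} -> R }.

Section PowerSeries.
Variables (I : choiceType) (R : comNzRingType).
Local Notation S := (pseries I R).
Implicit Types (f g h : S) (m : {cmonom I}).

HB.instance Definition _ := gen_eqMixin S.
HB.instance Definition _ := gen_choiceMixin S.

Lemma psP f g : (forall m, f m = g m) -> f = g.
Proof. by case: f g => [f] [g] eq_fg; congr PSeries; apply/funext. Qed.

Definition ps_zero : S := PSeries (fun=> 0).
Definition ps_opp f : S := PSeries (fun m => - f m).
Definition ps_add f g : S := PSeries (fun m => f m + g m).
Definition ps_scale (c : R) f : S := PSeries (fun m => c * f m).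
Definition ps_one : S := PSeries (fun m => (m == mone)%:R).
Definition ps_mul f g : S :=
  PSeries (fun m => \sum_(d <- cmdivs m) f d * g (divcm m d)).

Fact ps_addA : associative ps_add.
Proof. by move=> f g h; apply/psP => m; apply: addrA. Qed.
Fact ps_addC : commutative ps_add.
Proof. by move=> f g; apply/psP => m; apply: addrC. Qed.
Fact ps_add0 : left_id ps_zero ps_add.
Proof. by move=> f; apply/psP => m; apply: add0r. Qed.
Fact ps_addN : left_inverse ps_zero ps_opp ps_add.
Proof. by move=> f; apply/psP => m; apply: addNr. Qed.

HB.instance Definition _ :=
  GRing.isZmodule.Build S ps_addA ps_addC ps_add0 ps_addN.

(* The polynomial collecting the terms of f that divide m. *)
Definition ps_trunc m f : {malg R[{cmonom I}]} :=
  \sum_(d <- cmdivs m) << f d *g d >>.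

Lemma ps_truncE m f d : d \in cmdivs m -> (ps_trunc m f)@_d = f d.
Proof.
move=> d_m; rewrite /ps_trunc raddf_sum /= (big_fsetD1 d) //=.
rewrite big1_fset ?addr0; first exact: mcoeffUU.
by move=> e; rewrite !inE => /andP[/negbTE e_d _] _; rewrite mcoeffU e_d mulr0n.
Qed.

Lemma ps_mulE m f g d : d \in cmdivs m ->
  ps_mul f g d = (ps_trunc m f * ps_trunc m g)@_d.
Proof.
move=> d_m; rewrite mcoeffM_divs /= big_seq [RHS]big_seq.
by apply: eq_bigr => e e_d; rewrite !ps_truncE ?(cmdivs_trans d_m) ?divcm_cmdivs.
Qed.

Fact ps_mulC : commutative ps_mul.
Proof.
move=> f g; apply/psP => m; have mm := cmdivs_refl m.
rewrite (ps_mulE f g mm) (ps_mulE g f mm).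
by move: (ps_trunc m f) (ps_trunc m g) => a b; rewrite mulrC.
Qed.

Fact ps_mulA : associative ps_mul.
Proof.
move=> f g h; apply/psP => m.
transitivity (ps_trunc m f * (ps_trunc m g * ps_trunc m h))@_m.
  rewrite mcoeffM_divs [LHS]big_seq [RHS]big_seq.
  apply: eq_bigr => d d_m; rewrite (ps_truncE f d_m); congr (_ * _).
  exact/ps_mulE/divcm_cmdivs.
transitivity (ps_trunc m f * ps_trunc m g * ps_trunc m h)@_m.
  by move: (ps_trunc m f) (ps_trunc m g) (ps_trunc m h) => a b c; rewrite mulrA.
rewrite mcoeffM_divs [LHS]big_seq [RHS]big_seq.
apply: eq_bigr => d d_m; rewrite (ps_truncE h (divcm_cmdivs _ _)).
by congr (_ * _); apply/esym/ps_mulE.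
Qed.

Fact ps_mul1 : left_id ps_one ps_mul.
Proof.
move=> f; apply/psP => m /=.
have m1 : mone \in cmdivs m by apply/cmdivsP => i; rewrite cm1.
rewrite (big_fsetD1 mone) //= eqxx mul1r big1_fset ?addr0.
  by congr (f _); apply/eqP/cmP => i; rewrite divcmE cm1 subn0.
by move=> d /fsetD1P[/negbTE d1 _] _; rewrite d1 mul0r.
Qed.

Fact ps_mulDl : left_distributive ps_mul ps_add.
Proof.
move=> f g h; apply/psP => m; rewrite /= -big_split /=.
by apply: eq_bigr => d _; rewrite mulrDl.
Qed.

Fact ps_one_neq0 : ps_one != 0.
Proof.
apply/eqP => /(congr1 (fun f : S => f mone)) /= /eqP.
by rewrite eqxx oner_eq0.
Qed.

HB.instance Definition _ := GRing.Zmodule_isComNzRing.Build S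
  ps_mulA ps_mulC ps_mul1 ps_mulDl ps_one_neq0.

Fact ps_scaleA a b f : ps_scale a (ps_scale b f) = ps_scale (a * b) f.
Proof. by apply/psP => m; apply: mulrA. Qed.
Fact ps_scale1 : left_id 1 ps_scale.
Proof. by move=> f; apply/psP => m; apply: mul1r. Qed.
Fact ps_scaleDr : right_distributive ps_scale +%R.
Proof. by move=> a f g; apply/psP => m; apply: mulrDr. Qed.
Fact ps_scaleDl f : {morph ps_scale^~ f : a b / a + b}.
Proof. by move=> a b; apply/psP => m; apply: mulrDl. Qed.

HB.instance Definition _ := GRing.Zmodule_isLmodule.Build R S
  ps_scaleA ps_scale1 ps_scaleDr ps_scaleDl.

Fact ps_scaleAl (a : R) f g : a *: (f * g) = a *: f * g.
Proof.
apply/psP => m; rewrite [LHS]mulr_sumr; apply: eq_bigr => d _.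
by rewrite mulrA.
Qed.

HB.instance Definition _ := GRing.Lmodule_isLalgebra.Build R S ps_scaleAl.
HB.instance Definition _ := GRing.Lalgebra_isComAlgebra.Build R S.
End PowerSeries.

Section CmonomEval.
Variables (I : choiceType) (S : comNzRingType) (v : I -> S).

Definition cmeval (m : {cmonom I}) : S := \prod_(i <- finsupp m) v i ^+ m i.

Lemma cmevalEw (m : {cmonom I}) (A : {fset I}) : (finsupp m `<=` A)%fset ->
  cmeval m = \prod_(i <- A) v i ^+ m i.
Proof.
by move=> le_mA; apply: big_fset_incl le_mA _ => i _ /fsfun_dflt ->; rewrite expr0.
Qed.

Fact cmeval_is_mmorphism : mmorphism cmeval.
Proof.
split=> [m1 m2|]; last by rewrite /cmeval mdom1 big_seq_fset0.
rewrite (@cmevalEw m1 _ (fsubsetUl _ (finsupp m2))).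
rewrite (@cmevalEw m2 _ (fsubsetUr (finsupp m1) _)) /cmeval mdomD -big_split /=.
by apply: eq_bigr => i _; rewrite cmM exprD.
Qed.

HB.instance Definition _ := isMultiplicative.Build _ S cmeval
  cmeval_is_mmorphism.

Lemma cmevalU i : cmeval (ucm i) = v i.
Proof. by rewrite /cmeval mdomU big_seq_fset1 cmUU expr1. Qed.
End CmonomEval.

Section GeneratedIdeal.
Variables (R : comNzRingType) (G : R -> Prop).

Definition ideal_gen (p : R) : Prop :=
  exists2 s : seq (R * R), (forall x, x \in s -> G x.2)
                         & p = \sum_(x <- s) x.1 * x.2.

Lemma ideal_gen0 : ideal_gen 0.
Proof. by exists [::] => //; rewrite big_nil. Qed.

Lemma ideal_genMD a p q :
  ideal_gen p -> ideal_gen q -> ideal_gen (a * p + q).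
Proof.
move=> [s Gs ->] [t Gt ->]; exists ([seq (a * x.1, x.2) | x <- s] ++ t).
  by move=> x; rewrite mem_cat => /orP[/mapP[y /Gs Gy ->]|/Gt].
rewrite big_cat big_map mulr_sumr /=; congr (_ + _).
by apply: eq_bigr => x _; rewrite mulrA.
Qed.
End GeneratedIdeal.

(* The letter (i, true) stands for the primed letter i' and (i, false) for i; *)
(* variables are indexed from 0.                                              *)
Definition letter : Type := nat * bool.

(* The order 0' < 0 < 1' < 1 < ... *)
Definition letter_le (a b : letter) : bool :=
  (a.1 < b.1)%N || (a.1 == b.1) && (b.2 ==> a.2).

Definition row_filling (w : seq letter) : bool :=
  sorted letter_le w && all (fun a => a.2 ==> (count_mem a w <= 1)%N) w.

Definition row_weight (w : seq letter) : {cmonom nat} :=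
  \big[mmul/mone]_(a <- w) ucm a.1.

(* The fillings of a row of n cells of weight m, see row_fillingsP; their     *)
(* letters necessarily involve only the variables occurring in m.             *)
Definition row_fillings (n : nat) (m : {cmonom nat}) : {fset seq letter} :=
  [fset w in [fset [seq (val a.1, a.2) | a <- tval t]
               | t in {: n.-tuple (finsupp m * bool)}]
   | row_filling w && (row_weight w == m)]%fset.

Lemma row_weight_supp (w : seq letter) a :
  a \in w -> a.1 \in finsupp (row_weight w).
Proof.
elim: w => // b w IHw; rewrite inE /row_weight big_cons mdomD mdomU !inE.
by case/orP => [/eqP->|/IHw->]; rewrite ?eqxx ?orbT.
Qed.

Lemma row_fillingsP n m w :
  (w \in row_fillings n m) =
    [&& size w == n, row_filling w & row_weight w == m].
Proof.
rewrite !inE /=; apply/idP/idP => [/andP[/imfsetP[/= t _ ->] ->]|].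
  by rewrite size_map size_tuple eqxx.
case/and3P=> /eqP szw -> /eqP wm; rewrite wm eqxx !andbT.
have wP : all (fun a : letter => a.1 \in finsupp m) w.
  by apply/allP => a /row_weight_supp; rewrite wm.
have {wP} [s def_w] : exists s : seq (finsupp m * bool),
    w = [seq (val a.1, a.2) | a <- s].
  elim: w wP {szw wm} => [|[i b] w IHw] /=; first by exists [::].
  by case/andP=> im /IHw[s ->]; exists (([` im]%fset, b) :: s).
have szs : size s == n by rewrite -szw def_w size_map.
by apply/imfsetP; exists (Tuple szs).
Qed.

Local Notation QX := (pseries nat rat).

Definition qrow (n : nat) : QX := PSeries (fun m => #|` row_fillings n m|%:R).

Inductive in_Omega : QX -> Prop :=
| in_Omega_q n of (0 < n)%N : in_Omega (qrow n)
| in_Omega1 : in_Omega 1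
| in_OmegaB f g of in_Omega f & in_Omega g : in_Omega (f - g)
| in_OmegaM f g of in_Omega f & in_Omega g : in_Omega (f * g).

Definition Omega_pred : {pred QX} := fun f => `[< in_Omega f >].

Fact Omega_subring_closed : subring_closed Omega_pred.
Proof.
split=> [|f g /asboolP Of /asboolP Og|f g /asboolP Of /asboolP Og];
  apply/asboolP.
- exact: in_Omega1.
- exact: in_OmegaB.
- exact: in_OmegaM.
Qed.

HB.instance Definition _ :=
  GRing.isSubringClosed.Build QX Omega_pred Omega_subring_closed.

(* Omega is the subring Z[q_1, q_2, ...], taken inside Q[[x_0, x_1, ...]]. *)
Record Omega := OmegaElt { Omega_val :> QX; _ : Omega_val \in Omega_pred }.

HB.instance Definition _ := [isSub for Omega_val].
HB.instance Definition _ := [Choice of Omega by <:].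
HB.instance Definition _ := [SubChoice_isSubComNzRing of Omega by <:].

(* Omega being torsion free, its scalar extension from Z to Q is realised as  *)
(* the Q-subspace spanned by Omega in the power series; the universal         *)
(* property is QOmega_tensor.                                                 *)
Definition QOmega_pred : {pred QX} :=
  fun f => `[< exists (c : rat) (w : Omega), f = c *: (w : QX) >].

Lemma rat_common_denom (c d : rat) : exists (a b : int) (e : rat),
  [/\ e != 0, c = e * a%:~R & d = e * b%:~R].
Proof.
exists (numq c * denq d), (numq d * denq c), ((denq c)%:~R * (denq d)%:~R)^-1.
rewrite !intrM; have c0 : (denq c)%:~R != 0 :> rat by rewrite intr_eq0 denq_neq0.
have d0 : (denq d)%:~R != 0 :> rat by rewrite intr_eq0 denq_neq0.
split; first by rewrite invr_eq0 mulf_neq0.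
  by rewrite -{1}[c]divq_num_den invfM mulrACA mulVf // mulr1 mulrC.
by rewrite -{1}[d]divq_num_den invfM [_^-1 * _^-1]mulrC mulrACA mulVf // mulr1 mulrC.
Qed.

Lemma OmegaZ (a : int) (w : Omega) : a%:~R *: (w : QX) = (w *~ a : Omega).
Proof. by rewrite scaler_int; apply/esym/(raddfMz (\val : Omega -> QX)). Qed.

Fact QOmega_subalg_closed : GRing.subalg_closed QOmega_pred.
Proof.
split.
- by apply/asboolP; exists 1, 1; rewrite scale1r.
- move=> k _ _ /asboolP[c [v ->]] /asboolP[d [w ->]]; apply/asboolP.
  have [a [b [e [_ def_c def_d]]]] := rat_common_denom (k * c) d.
  exists e, (v *~ a + w *~ b).
  by rewrite scalerA def_c def_d -!scalerA !OmegaZ -scalerDr.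
- move=> _ _ /asboolP[c [v ->]] /asboolP[d [w ->]]; apply/asboolP.
  by exists (c * d), (v * w); rewrite -scalerAl -scalerAr scalerA.
Qed.

HB.instance Definition _ :=
  GRing.isSubalgClosed.Build rat QX QOmega_pred QOmega_subalg_closed.

Record QOmega := QOmegaElt { QOmega_val :> QX; _ : QOmega_val \in QOmega_pred }.

HB.instance Definition _ := [isSub for QOmega_val].
HB.instance Definition _ := [Choice of QOmega by <:].
HB.instance Definition _ := [SubChoice_isSubComNzRing of QOmega by <:].
HB.instance Definition _ := [SubZmodule_isSubLmodule of QOmega by <:].
HB.instance Definition _ := [SubNzRing_SubLmodule_isSubLalgebra of QOmega by <:].
HB.instance Definition _ := [SubLalgebra_isSubAlgebra of QOmega by <:].

Fact tens_subproof (c : rat) (w : Omega) : c *: (w : QX) \in QOmega_pred.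
Proof. by apply/asboolP; exists c, w. Qed.

Definition tens (c : rat) (w : Omega) : QOmega := QOmegaElt (tens_subproof c w).

Lemma tensP (f : QOmega) : exists cw : rat * Omega, f = tens cw.1 cw.2.
Proof.
by case: f => f fP; have /asboolP[c [w def_f]] := fP; exists (c, w); apply: val_inj.
Qed.

Lemma morphMz (U V : zmodType) (phi : U -> V) :
  {morph phi : x y / x + y} -> forall n : int, {morph phi : x / x *~ n}.
Proof.
move=> phiD n x; have phi0 : phi 0 = 0.
  by apply: (addrI (phi 0)); rewrite -phiD !addr0.
pose phi' : {additive U -> V} :=
  HB.pack phi (GRing.isNmodMorphism.Build U V phi (conj phi0 phiD)).
exact: (raddfMz phi').
Qed.

Lemma QOmega_tensor (A : zmodType) (b : rat -> Omega -> A) :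
  (forall c, {morph b c : v w / v + w}) ->
  (forall w, {morph b^~ w : c d / c + d}) ->
  exists2 g : {additive QOmega -> A}, (forall c w, g (tens c w) = b c w)
    & forall g' : {additive QOmega -> A},
        (forall c w, g' (tens c w) = b c w) -> g' =1 g.
Proof.
move=> bDr bDl.
have bZ e a w : b (e * a%:~R) w = b e (w *~ a).
  by rewrite mulrzr (morphMz (bDl w)) (morphMz (bDr e)).
have b_wd c d v w : tens c v = tens d w -> b c v = b d w.
  have [a1 [a2 [e [e0 -> ->]]]] := rat_common_denom c d.
  move=> /(congr1 QOmega_val) /=; rewrite -!scalerA !OmegaZ => /(scalerI e0).
  by move=> /val_inj eq_vw; rewrite !bZ eq_vw.
have [r rP] := choice tensP.
pose g f := b (r f).1 (r f).2.
have gE c w : g (tens c w) = b c w by apply: b_wd; rewrite -rP.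
have gD : {morph g : f1 f2 / f1 + f2}.
  move=> f1 f2; have [c [v [w [def1 def2]]]] : exists c v w,
      f1 = tens c v /\ f2 = tens c w.
    have [a1 [a2 [e [_ e1 e2]]]] := rat_common_denom (r f1).1 (r f2).1.
    exists e, ((r f1).2 *~ a1), ((r f2).2 *~ a2).
    split; [rewrite {1}(rP f1) e1 | rewrite {1}(rP f2) e2];
      by apply: val_inj; rewrite /= -OmegaZ scalerA.
  have -> : f1 + f2 = tens c (v + w).
    by apply: val_inj; rewrite def1 def2 /= scalerDr.
  by rewrite def1 def2 !gE bDr.
have g0 : g 0 = 0 by apply: (addrI (g 0)); rewrite -gD !addr0.
pose g' : {additive QOmega -> A} :=
  HB.pack g (GRing.isNmodMorphism.Build QOmega A g (conj g0 gD)).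
by exists g' => [//|h hE f]; rewrite (rP f) hE [RHS]gE.
Qed.

Fact qOmega_subproof n : qrow n.+1 \in Omega_pred.
Proof. by apply/asboolP/in_Omega_q. Qed.

Definition qOmega (n : int) : Omega :=
  match n with
  | Posz 0 => 1
  | Posz n.+1 => OmegaElt (qOmega_subproof n)
  | Negz _ => 0
  end.

Definition is_composition (s : seq nat) : bool :=
  (s != [::]) && all (fun a => 0 < a)%N s.

Record composition :=
  Composition { parts :> seq nat; _ : is_composition parts }.

HB.instance Definition _ := [isSub for parts].
HB.instance Definition _ := [Choice of composition by <:].

Definition seq_odot (s t : seq nat) : seq nat :=
  belast (head 0 s) (behead s) ++ (last 0 s + head 0 t)%N :: behead t.

Fact comp_dot_subproof (a b : composition) : is_composition (a ++ b).
Proof.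
case: a b => [s /andP[s0 sP]] [t /andP[_ tP]] /=.
by rewrite /is_composition all_cat sP tP; case: s s0 {sP}.
Qed.

Fact comp_odot_subproof (a b : composition) : is_composition (seq_odot a b).
Proof.
case: a b => [[|x s] //= /andP[_ sP]] [[|y t] //= /andP[_ /= /andP[y0 tP]]].
rewrite /seq_odot /is_composition all_cat /= tP addn_gt0 y0 orbT !andbT.
apply/andP; split; first by case: (belast x s).
by move: sP; rewrite lastI all_rcons => /andP[].
Qed.

Fact comp_row_subproof n (n_gt0 : (0 < n)%N) : is_composition [:: n].
Proof. by rewrite /is_composition /= n_gt0. Qed.

Fact comp_ones_subproof n (n_gt0 : (0 < n)%N) : is_composition (nseq n 1%N).
Proof. by case: n n_gt0 => // n _; rewrite /is_composition /= all_nseq orbT. Qed.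

Definition comp_dot a b : composition := Composition (comp_dot_subproof a b).
Definition comp_odot a b : composition := Composition (comp_odot_subproof a b).
Definition comp_row n (n_gt0 : (0 < n)%N) : composition :=
  Composition (comp_row_subproof n_gt0).
Definition comp_ones n (n_gt0 : (0 < n)%N) : composition :=
  Composition (comp_ones_subproof n_gt0).

(* The ribbon with rows a_0, a_1, ... from the top is the skew diagram        *)
(* nu / kappa (English convention) in which the first cell of each row lies   *)
(* above the last cell of the next one, see ribbon_outerS.                    *)
Definition ribbon_inner (a : seq nat) (i : nat) : nat :=
  (\sum_(i.+1 <= j < size a) (nth 0 a j).-1)%N.
Definition ribbon_outer (a : seq nat) (i : nat) : nat :=
  (ribbon_inner a i + nth 0 a i)%N.

Lemma ribbon_inner_last (a : seq nat) : ribbon_inner a (size a).-1 = 0%N.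
Proof. by rewrite /ribbon_inner big_geq //; case: a. Qed.

Lemma ribbon_outerS (a : composition) i : (i.+1 < size a)%N ->
  ribbon_outer a i.+1 = (ribbon_inner a i).+1.
Proof.
move=> ltia; rewrite /ribbon_outer /ribbon_inner [in RHS]big_ltn //.
rewrite addnC -addSn prednK //.
by have /andP[_ /allP aP] := valP a; apply/aP/mem_nth.
Qed.

Definition ribbonQ (a : composition) : Omega :=
  \det (\matrix_(i < size a, j < size a)
    qOmega ((ribbon_outer a i)%:Z - (ribbon_inner a j)%:Z - i%:Z + j%:Z)).

Notation Qz := {malg rat[{cmonom composition}]}.

Definition zvar (a : composition) : Qz := << ucm a >>.

Definition xi m (m_gt0 : (0 < 2 * m)%N) : Qz :=
  zvar (comp_row m_gt0) - zvar (comp_ones m_gt0).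

Inductive ribbon_rel : Qz -> Prop :=
| ribbon_rel_mul a b :
    ribbon_rel (zvar a * zvar b - zvar (comp_dot a b) - zvar (comp_odot a b))
| ribbon_rel_even m (m_gt0 : (0 < 2 * m)%N) : ribbon_rel (xi m_gt0).

Definition ribbon_ideal : {pred Qz} := fun p => `[< ideal_gen ribbon_rel p >].

Fact ribbon_ideal_closed : idealr_closed ribbon_ideal.
Proof.
have [aug augz] : exists aug : {rmorphism Qz -> rat}, forall a, aug (zvar a) = 0.
  by exists (mcoeff mone) => a; rewrite [LHS]mcoeffU cm1_eq1.
have augB y z : aug y = 0 -> aug z = 0 -> aug (y - z) = 0.
  by move=> y0 z0; rewrite rmorphB y0 z0 subr0.
have augM y z : aug y = 0 -> aug (y * z) = 0.
  by move=> y0; rewrite rmorphM y0 mul0r.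
split; first by apply/asboolP/ideal_gen0.
  apply/asboolP => -[s Gs /(congr1 aug)]; rewrite rmorph1 rmorph_sum.
  rewrite big1_seq /= => [/eqP|x /Gs Gx]; first by rewrite oner_eq0.
  rewrite mulrC; apply: (augM); case: Gx => [a b|m m_gt0].
    exact: (augB _ _ (augB _ _ (augM _ _ (augz _)) (augz _)) (augz _)).
  exact: augB (augz _) (augz _).
by move=> a p r /asboolP Ip /asboolP Ir; apply/asboolP/ideal_genMD.
Qed.

HB.instance Definition _ := isIdealr.Build Qz ribbon_ideal ribbon_ideal_closed.

Definition ribbon_hom : Qz -> QOmega :=
  mmap (GRing.in_alg QOmega) (cmeval (fun a => tens 1 (ribbonQ a))).

HB.instance Definition _ := GRing.RMorphism.on ribbon_hom.

Fact ribbon_hom_is_scalable : scalable ribbon_hom.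
Proof. by move=> c p; rewrite /ribbon_hom mmapZ /= mulr_algl. Qed.

HB.instance Definition _ :=
  GRing.isScalable.Build rat Qz QOmega *:%R ribbon_hom ribbon_hom_is_scalable.

Lemma ribbon_homE a : ribbon_hom (zvar a) = tens 1 (ribbonQ a).
Proof. by rewrite /ribbon_hom mmapU /= scale1r mul1r cmevalU. Qed.

(* Main.v *)
Require Import Defs.
From HB Require Import structures.
From mathcomp Require Import all_boot all_order all_algebra ring_quotient.
From mathcomp Require Import finmap boolp monalg.
From mathcomp Require Import zify ring.

(** Expanding the Hessenberg determinant along its first column gives
    [r_(a, b, t) = q_a r_(b, t) - r_(a + b, t)], from which the product rule
    follows by induction.  The Euler derivations [theta_i = x_i d/dx_i] satisfy
    [theta_i q_(n+2) = x_i^2 theta_i q_n + 2 x_i q_(n+1)], so they kill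
    [\sum_j (-1)^j q_j q_(n-j)]; hence that sum vanishes for [n > 0], and this
    identity turns into [r_(1^n) = q_n].  Conversely, modulo the ideal the same
    recursion writes [z_(1^(2m))] as [- z_(2m)] plus a polynomial in the [z_j]
    with [j < 2m], so [xi_(2m)] eliminates [z_(2m)] and every element reduces to
    a polynomial in [z_1, z_3, ...].  It remains that [q_1, q_3, ...] are
    algebraically independent: applying all [theta_i] to a relation of minimal
    degree shows that its partial derivatives are relations as well. *)

Set Implicit Arguments.
Unset Strict Implicit.
Unset Printing Implicit Defensive.

Import GRing.Theory Num.Theory.

Local Open Scope ring_scope.
Local Open Scope quotient_scope.

(** * Ribbon determinants *)

Section RibbonRecursion.
Variables (R : comNzRingType) (h : nat -> R).

(** The ribbon determinant in abstract entries [h]; unrolled, it is the alternating sum, over all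
    coarsenings of [a :: s], of the products of the corresponding [h]. *)
Fixpoint rib (a : nat) (s : seq nat) : R :=
  if s is b :: t then h a * rib b t - rib (a + b) t else h a.

(** The recursion splits the left factor into ribbons starting with [c] and [a + c]. Both obey the
    rule by induction, and the four resulting terms regroup into the two ribbons on the right. *)
Lemma rib_mul a s b t :
  rib a s * rib b t = rib a (s ++ b :: t)
    + rib (head 0 (seq_odot (a :: s) (b :: t)))%N
          (behead (seq_odot (a :: s) (b :: t))).
Proof.
elim: s a => [|c s IHs] a /=; first by rewrite subrK.
have H1 := IHs c; have H2 := IHs (a + c)%N.
rewrite mulrBl -mulrA H1 H2 {H1 H2 IHs}.
(* If [c] is the last part, it is the one that merges with [b]. *)
by case: s => [|d s] /=; rewrite ?addnA mulrDr opprD addrACA.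
Qed.

Definition hessenberg (a : seq nat) : 'M[R]_(size a) :=
  \matrix_(i, j) if (i <= j)%N then h (\sum_(i <= l < j.+1) nth 0 a l)%N
                 else (i == j.+1 :> nat)%:R.

(** The first column has two nonzero entries, [h x] and the subdiagonal 1. Deleting the second row
    instead of the first merges the first two parts. *)
Lemma det_hessenberg x s : \det (hessenberg (x :: s)) = rib x s.
Proof.
elim: s x => [|b t IHt] x.
  by rewrite [\det _]det_mx11 mxE big_nat1.
rewrite (expand_det_col _ ord0) /=.
rewrite 2!big_ord_recl big1 => [|i _]; last by rewrite mxE /= mul0r.
rewrite !mxE /= big_nat1 mul1r addr0 /cofactor /= addn0 expr0 expr1 mul1r mulN1r.
congr (_ * _ - _); rewrite -IHt; congr (\det _).
  by apply/matrixP => i j; rewrite !mxE /= !big_add1.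
apply/matrixP => i j; rewrite !mxE /=; case: i => -[|i] lti /=.
  rewrite /bump !add1n /= 2?big_nat_recl //. rewrite [in RHS]big_nat_recl //=.
  by rewrite addnA.
rewrite /bump !add1n /= ltnS; congr (if _ then h _ else _).
by rewrite !big_add1.
Qed.
End RibbonRecursion.

Lemma rib_morph (R S : comNzRingType) (f : {rmorphism R -> S}) (h : nat -> R) a s :
  f (rib h a s) = rib (f \o h) a s.
Proof.
elim: s a => [|b t IHt] a //=.
by rewrite rmorphB rmorphM !IHt.
Qed.

Lemma eq_rib (R : comNzRingType) (g h : nat -> R) a s :
  g =1 h -> rib g a s = rib h a s.
Proof. by move=> gh; elim: s a => [|b t IHt] a /=; rewrite ?IHt gh. Qed.

Lemma ribbonQE (a : composition) :
  ribbonQ a = rib (fun n => qOmega n%:Z) (head 0 a)%N (behead a).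
Proof.
have /andP[_ /allP aP] := valP a.
have apos i : (i < size a)%N -> (0 < nth 0 a i)%N by move=> lti; apply/aP/mem_nth.
rewrite -det_hessenberg /ribbonQ.
have -> : head 0%N a :: behead a = a by case: a {aP apos} => -[].
congr (\det _); apply/matrixP => i j; rewrite !mxE.
have sumE k l : (k <= l)%N -> (l < size a)%N ->
   (\sum_(k <= u < l.+1) nth 0 a u =
    nth 0 a k + \sum_(k.+1 <= u < l.+1) (nth 0 a u).-1 + (l - k))%N.
  move=> lekl ltl; rewrite big_ltn // -addnA; congr (_ + _)%N.
  transitivity (\sum_(k.+1 <= u < l.+1) ((nth 0%N a u).-1 + 1))%N.
    by apply: eq_big_nat => u /andP[_ ltu]; rewrite addn1 prednK // apos //; lia.
  by rewrite big_split /= sum_nat_const_nat muln1 subSS.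
have inner_mono k l : (k <= l)%N -> (ribbon_inner a l <= ribbon_inner a k)%N.
  move=> lekl; rewrite /ribbon_inner.
  have [lel|gel] := leqP (size a) l.+1; first by rewrite [X in (X <= _)%N]big_geq.
  rewrite [X in (_ <= X)%N](@big_cat_nat _ _ _ l.+1) //=; [exact: leq_addl | exact: ltnW].
(* On and above the diagonal the index telescopes to a_i + ... + a_j. Just below the diagonal it is
   0, giving q_0 = 1; further down it is negative, giving 0. *)
have [leij|ltji] := leqP i j.
  congr qOmega; rewrite sumE //.
  rewrite /ribbon_outer.
  have := inner_mono i j leij.
  set S := (\sum_(_ <= _ < _) _)%N; rewrite -/S.
  have : (ribbon_inner a i = ribbon_inner a j + S)%N.
    by rewrite /ribbon_inner /S (@big_cat_nat _ _ _ j.+1) //= addnC.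
  lia.
have [def_i|neq] := eqVneq (nat_of_ord i) j.+1.
  have : (j.+1 < size a)%N by rewrite -def_i.
  move=> /ribbon_outerS; rewrite -def_i => ->.
  by have -> : (ribbon_inner a j).+1%:Z - (ribbon_inner a j)%:Z - i%:Z + j%:Z = 0 by lia.
have : exists k, (ribbon_outer a i)%:Z - (ribbon_inner a j)%:Z - i%:Z + j%:Z = Negz k.
  have [k def_i] : exists k, nat_of_ord i = k.+1 by exists i.-1; lia.
  have : (k.+1 < size a)%N by rewrite -def_i.
  move=> /ribbon_outerS; rewrite -def_i => ->.
  have lejk : (j <= k)%N by lia.
  have := inner_mono _ _ lejk => le1.
  exists (ribbon_inner a j - ribbon_inner a k + (k - j).-1)%N; lia.
by case=> k ->.
Qed.

(** * Single-row functions *)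

Section RowFillings.
Local Open Scope fset_scope.
Local Open Scope nat_scope.

Lemma letter_le_trans : transitive letter_le.
Proof. by move=> [j b] [i a] [k c]; rewrite /letter_le /=; case: a b c => [] [] []; lia. Qed.

Lemma letter_le_anti : antisymmetric letter_le.
Proof.
move=> [i a] [j b]; rewrite /letter_le /= => H.
have -> : i = j by lia.
by congr (_, _); case: a b H => [] [] /=; lia.
Qed.

Lemma letter_le_total : total letter_le.
Proof. by move=> [i a] [j b]; rewrite /letter_le /=; case: a b => [] []; lia. Qed.

Lemma row_weightE w i :
  row_weight w i = count_mem (i, true) w + count_mem (i, false) w.
Proof.
elim: w => [|[j b] w IHw]; first by rewrite /row_weight big_nil cm1.
rewrite /row_weight big_cons cmM IHw cmU /= !xpair_eqE.
by case: b; rewrite /= ?andbT ?andbF; lia.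
Qed.

Lemma mdeg_row_weight w : mdeg (row_weight w) = size w.
Proof.
elim: w => [|a w IHw]; first by rewrite /row_weight big_nil mdeg1.
by rewrite /row_weight big_cons mdegM IHw mdegU.
Qed.

Variable m : {cmonom nat}.

(* The filling of weight m whose primed letters are the elements of S. *)
Definition primed_filling (S : {fset nat}) : seq letter :=
  sort letter_le (flatten [seq nseq (i \in S) (i, true)
                            ++ nseq (m i - (i \in S)) (i, false) | i <- finsupp m]).

Lemma count_primed_filling (S : {fset nat}) i b : S `<=` finsupp m ->
  count_mem (i, b) (primed_filling S) = if b then nat_of_bool (i \in S) else m i - (i \in S).
Proof.
move=> /fsubsetP Sm; rewrite count_sort count_flatten -map_comp sumnE big_map.
pose F j := if b then nat_of_bool (j \in S) else m j - (j \in S).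
transitivity (\sum_(j <- finsupp m) (if j == i then F j else 0)).
  apply: eq_bigr => j _ /=; rewrite count_cat !count_nseq /= !xpair_eqE /F.
  by case: b @F; case: (j == i) => /=; lia.
rewrite -big_mkcond big_fset_condE /=.
have [im|im] := boolP (i \in finsupp m).
  rewrite (_ : [fset _ | _ in _ & _] = [fset i]) ?big_seq_fset1 //.
  by apply/fsetP => j; rewrite !inE /= andbC; case: eqP => // ->; rewrite im.
rewrite (_ : [fset _ | _ in _ & _] = fset0); last first.
  apply/fsetP => j; rewrite !inE /= andbC; case: eqP => // ->; exact/negbTE.
rewrite big_seq_fset0 (fsfun_dflt im).
by case: b @F; rewrite // (contraNF (Sm i)).
Qed.

Lemma primed_filling_row S : S `<=` finsupp m ->
  row_filling (primed_filling S) && (row_weight (primed_filling S) == m).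
Proof.
move=> Sm; apply/andP; split; last first.
  apply/cmP => i; rewrite row_weightE !count_primed_filling //.
  have /fsubsetP/(_ i) := Sm; rewrite -cmE_neq0.
  by case: (i \in S) => /= [/(_ isT)|_]; lia.
rewrite /row_filling sort_sorted ?letter_le_total; last exact: letter_le_total.
apply/allP => -[i b] _ /=; apply/implyP => ->.
by rewrite count_primed_filling // leq_b1.
Qed.

Lemma primed_filling_inj :
  {in fpowerset (finsupp m) &, injective primed_filling}.
Proof.
move=> S T; rewrite !fpowersetE => Sm Tm eqST; apply/fsetP => i.
have := congr1 (count_mem (i, true)) eqST.
by rewrite !count_primed_filling //; do 2!case: (i \in _).
Qed.

(** A sorted word is determined by its letter counts, and the weight fixes how often i and i' occur
    together. The only freedom is whether i' occurs, for each variable of [m]. *)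
Lemma row_fillings_primed :
  row_fillings (mdeg m) m = [fset primed_filling S | S in fpowerset (finsupp m)].
Proof.
apply/fsetP => w; rewrite row_fillingsP; apply/and3P/imfsetP => [[_ wF /eqP wm]|].
  have /andP[ws wp] := wF.
  pose S := [fset i in finsupp m | (i, true) \in w].
  have Sm : S `<=` finsupp m by apply/fsubsetP => i; rewrite !inE => /andP[].
  exists S; first by rewrite /= fpowersetE.
  apply: (sorted_eq letter_le_trans letter_le_anti) => //.
    by rewrite sort_sorted //; exact: letter_le_total.
  apply/allP => -[i b] _; apply/eqP; rewrite /= count_primed_filling //.
  have ctrue : count_mem (i, true) w = (i \in S).
    rewrite !inE /=; have [iw|iw] := boolP ((i, true) \in w); last first.
      by rewrite andbF; apply/count_memPn.
    have /allP/(_ _ iw) /= le1 := wp.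
    have := row_weight_supp iw; rewrite wm /= => ->.
    by apply/eqP; rewrite eqn_leq le1 /= -has_count has_pred1.
  by case: b => //; rewrite -wm row_weightE ctrue addKn.
case=> S; rewrite /= fpowersetE => Sm ->.
have /andP[wF /eqP wm] := primed_filling_row Sm; split=> //; last exact/eqP.
by rewrite -mdeg_row_weight wm.
Qed.

End RowFillings.

(** These are the coefficients of the generating function \prod_i (1 + x_i t)/(1 - x_i t). *)
Lemma qrowE n (m : {cmonom nat}) :
  qrow n m = if mdeg m == n then 2 ^+ #|` finsupp m| else 0.
Proof.
rewrite /=; case: eqP => [<-|neq].
  rewrite row_fillings_primed card_in_imfset /=; last exact: primed_filling_inj.
  by rewrite card_fpowerset natrX.
suff -> : row_fillings n m = fset0 by rewrite cardfs0.
apply/fsetP => w; rewrite row_fillingsP in_fset0; apply/and3P => -[/eqP sw _ /eqP wm].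
by case: neq; rewrite -wm mdeg_row_weight.
Qed.

(** * Columns of ones and the convolution identity *)

Section ConvolutionRib.
Variables (R : comNzRingType) (h : nat -> R).

(** Unrolling the recursion absorbs the ones into the first part one at a time. The hypothesis
    covers only columns shorter than the hook's tail, which is what the strong induction in
    [rib_ones] supplies. *)
Lemma rib_hook a n : h 0%N = 1 ->
  (forall j, (j < n)%N -> rib h 1 (nseq j 1%N) = h j.+1) ->
  rib h a (nseq n 1%N) = \sum_(j < n.+1) (-1) ^+ j * h (a + j)%N * h (n - j)%N.
Proof.
move=> h0; elim: n a => [|n IHn] a IH /=.
  by rewrite big_ord1 /= expr0 mul1r addn0 h0 mulr1.
rewrite IH // IHn => [|j ltj]; last by apply: IH; apply: leqW.
rewrite [RHS]big_ord_recl /= expr0 mul1r addn0 subn0 -sumrN; congr (_ + _).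
by apply: eq_bigr => j _; rewrite /bump /= add1n subSS exprS !mulN1r !mulNr addn1 addSnnS.
Qed.

(** The hook expansion with first part 1 is, up to sign, the vanishing convolution of degree n + 1
    without its term j = 0, which is [h n.+1]. *)
Lemma rib_ones n : h 0%N = 1 ->
  (forall k, (0 < k)%N -> \sum_(j < k.+1) (-1) ^+ j * (h j * h (k - j)%N) = 0) ->
  rib h 1 (nseq n 1%N) = h n.+1.
Proof.
move=> h0 hc; elim/ltn_ind: n => n IHn.
rewrite rib_hook //; have := hc n.+1 isT.
rewrite big_ord_recl /= expr0 mul1r subn0 h0 mul1r => /eqP.
rewrite addr_eq0 => /eqP ->; rewrite -sumrN; apply: eq_bigr => j _.
by rewrite /bump /= !add1n subSS exprS mulN1r mulNr opprK mulrA.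
Qed.
End ConvolutionRib.

(** * Monomials, power series and Euler derivations *)

Section MonomialSupport.
Variable I : choiceType.
Implicit Types (m : {cmonom I}) (i : I).

Lemma cmonom_neq1 m : m != mone -> exists i, m i != 0%N.
Proof.
move=> m1; have /fset0Pn[i mi] : finsupp m != fset0; last by exists i; rewrite cmE_neq0.
apply: contra m1 => /eqP m0; apply/cmP => i; rewrite cm1; apply/eqP.
by rewrite cmE_eq0 m0 in_fset0.
Qed.

Lemma mulm_ucm_divcm i m : m i != 0%N -> m = mmul (ucm i) (divcm m (ucm i)).
Proof.
move=> mi; rewrite mul_cmdivs //; apply/cmdivsP => j; rewrite cmU.
by case: eqP => // <-; rewrite lt0n.
Qed.

End MonomialSupport.

Section EulerDerivation.
Variables (I : choiceType) (R : comNzRingType).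
Local Notation S := (pseries I R).
Implicit Types (f g : S) (m : {cmonom I}) (i : I).

Lemma psDE f g m : (f + g) m = f m + g m. Proof. by []. Qed.
Lemma psZE c f m : (c *: f) m = c * f m. Proof. by []. Qed.
Lemma psME f g m : (f * g) m = \sum_(d <- cmdivs m) f d * g (divcm m d).
Proof. by []. Qed.

Lemma ps_sumE (J : Type) (r : seq J) (P : pred J) (F : J -> S) m :
  (\sum_(j <- r | P j) F j) m = \sum_(j <- r | P j) F j m.
Proof. by elim/big_rec2: _ => // j x y _ <-. Qed.

Lemma psM_mone f g : (f * g) mone = f mone * g mone.
Proof.
rewrite psME (_ : cmdivs mone = [fset mone]%fset).
  by rewrite big_seq_fset1 (_ : divcm _ _ = mone) //; apply/eqP/cmP=> i; rewrite divcmE cm1.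
apply/fsetP => d; rewrite in_fset1; apply/cmdivsP/eqP => [le_d|->]; last by move=> i; exact: leqnn.
by apply/eqP/cmP => i; apply/eqP; have := le_d i; rewrite cm1 leqn0.
Qed.

Definition psX i : S := PSeries (fun m => (m == ucm i)%:R).

Lemma psX_mul0 i f m : m i = 0%N -> (psX i * f) m = 0.
Proof.
move=> mi0; rewrite psME big1_seq // => d /andP[_ /cmdivsP le_dm] /=.
case: eqP => [def_d|]; last by rewrite mul0r.
by have := le_dm i; rewrite def_d cmUU mi0.
Qed.

Lemma psX_mulU i f m : (psX i * f) (mmul (ucm i) m) = f m.
Proof.
rewrite psME (big_fsetD1 (ucm i)) ?cmdivsM //= eqxx mul1r divcmM.
by rewrite big1_fset ?addr0 // => d /fsetD1P[/negbTE-> _]; rewrite mul0r.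
Qed.

Lemma psXn_mul_lt i n f m : (m i < n)%N -> (psX i ^+ n * f) m = 0.
Proof.
elim: n m => // n IHn m ltmn; rewrite exprS -mulrA.
have [mi0|mi_gt0] := posnP (m i); first exact: psX_mul0.
by rewrite {1}(@mulm_ucm_divcm _ i m) -?lt0n //  psX_mulU IHn // divcmE cmUU; lia.
Qed.

Lemma psXn_mulU i n f m : (psX i ^+ n * f) (iter n (mmul (ucm i)) m) = f m.
Proof.
elim: n => [|n IHn]; first by rewrite mul1r.
by rewrite exprS -mulrA psX_mulU.
Qed.

Lemma iter_ucmE i n m : (iter n (mmul (ucm i)) m) i = (n + m i)%N.
Proof. by elim: n => //= n IHn; rewrite cmM cmUU IHn. Qed.

(* The derivation x_i d/dx_i; unlike d/dx_i, it does not shift monomials. *)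
Definition theta i f : S := PSeries (fun m => (m i)%:R * f m).

Lemma thetaE i f m : theta i f m = (m i)%:R * f m. Proof. by []. Qed.

Lemma theta_is_linear i : linear (theta i).
Proof. by move=> c f g; apply/psP => m /=; rewrite mulrDr mulrCA. Qed.

HB.instance Definition _ i := GRing.isLinear.Build R S S *:%R (theta i) (theta_is_linear i).

Lemma thetaM i f g : theta i (f * g) = theta i f * g + f * theta i g.
Proof.
apply/psP => m; rewrite psDE !psME /= mulr_sumr -big_split /=.
rewrite big_seq [RHS]big_seq; apply: eq_bigr => d d_m.
rewrite -{1}(mul_cmdivs d_m) cmM natrD; ring.
Qed.

Lemma theta1 i : theta i 1 = 0.
Proof.
apply/psP => m /=; case: eqP => [->|]; last by rewrite mulr0.
by rewrite cm1 mul0r.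
Qed.

End EulerDerivation.

(** Some [theta i] multiplies the coefficient of [m] by a positive integer, invertible in
    characteristic zero. *)
Lemma theta_eq0 (I : choiceType) (f : pseries I rat) (m : {cmonom I}) :
  (forall i, theta i f = 0) -> m != mone -> f m = 0.
Proof.
move=> f0 m1; have [i mi] := cmonom_neq1 m1.
have := congr1 (fun g : pseries I rat => g m) (f0 i) => /= /eqP.
by rewrite mulf_eq0 pnatr_eq0 (negbTE mi) => /eqP.
Qed.

(** * Recurrences and the quadratic identity for q_n *)

Section RowQ.
Local Notation q := qrow.
Implicit Types (m : {cmonom nat}).

Lemma qrow0 : q 0 = 1.
Proof.
apply/psP => m; rewrite qrowE /= mdeg_eq0; case: eqP => [->|//].
by rewrite mdom1 cardfs0.
Qed.

Lemma qrow_mone n : (0 < n)%N -> q n mone = 0.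
Proof. by rewrite qrowE mdeg1; case: n. Qed.

(** Multiplying by x_i enlarges the support, and so doubles the coefficient, exactly when x_i does
    not yet occur. *)
Lemma qrow_ucm n i m :
  q n.+1 (mmul (ucm i) m) = (if m i == 0%N then 2 else 1) * q n m.
Proof.
rewrite !qrowE mdegM mdegU add1n eqSS; case: eqP => _; last by rewrite mulr0.
rewrite mdomD mdomU cmE_eq0 cardfsU1; case: (i \in _) => /=; first by rewrite mul1r.
by rewrite add1n exprS.
Qed.

Lemma theta_qrow1 i : theta i (q 1) = 2 *: psX rat i.
Proof.
apply/psP => m; have [mi0|mi0] := eqVneq (m i) 0%N.
  rewrite /= mi0 mul0r; case: eqP => [def_m|]; last by rewrite mulr0.
  by move: mi0; rewrite def_m cmUU.
rewrite (mulm_ucm_divcm mi0) -[psX rat i]mulr1 [RHS]psZE psX_mulU thetaE.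
move: (divcm _ _) => {mi0}m; rewrite qrow_ucm -qrow0 cmM cmUU qrowE.
rewrite mdeg_eq0; case: (m =P mone) => [->|_]; last by rewrite !mulr0.
by rewrite cm1 eqxx addn0 mul1r.
Qed.

(** The logarithmic derivative of (1 + x_i t)/(1 - x_i t) is 2 x_i t/(1 - x_i^2 t^2); clearing the
    denominator gives the recurrence. The proof compares coefficients, the exponent of x_i being 0,
    1 or at least 2. *)
Lemma theta_qrowSS i n :
  theta i (q n.+2) = psX rat i ^+ 2 * theta i (q n) + 2 *: (psX rat i * q n.+1).
Proof.
apply/psP => m; rewrite [RHS]psDE expr2 -mulrA psZE thetaE.
have [mi0|mi0] := eqVneq (m i) 0%N; first by rewrite !psX_mul0 // mi0 mul0r mulr0 addr0.
rewrite (mulm_ucm_divcm mi0) !psX_mulU; move: (divcm _ _) => {mi0}m.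
rewrite !qrow_ucm cmM cmUU.
have [mi0|mi0] := eqVneq (m i) 0%N.
  by rewrite psX_mul0 // mi0 add0r mul1r.
rewrite {mi0}(mulm_ucm_divcm mi0) psX_mulU; move: (divcm _ _) => {}m.
rewrite qrow_ucm cmM cmUU thetaE.
rewrite !natrD; case: eqP => [->|_]; ring.
Qed.

Lemma theta_qrow_odd i k :
  theta i (q k.*2.+1) = 2 *: \sum_(l < k.+1) psX rat i ^+ l.*2.+1 * q (k - l).*2.
Proof.
elim: k => [|k IHk]; first by rewrite theta_qrow1 big_ord1 qrow0 mulr1.
rewrite doubleS theta_qrowSS IHk [in RHS]big_ord_recl addrC scalerDr /=.
rewrite subn0 doubleS expr1.
congr (_ + _); rewrite -scalerAr; congr (_ *: _); rewrite mulr_sumr.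
by apply: eq_bigr => l _; rewrite mulrA -exprD.
Qed.

Lemma qrow_conv n : (0 < n)%N ->
  \sum_(j < n.+1) (-1) ^+ j * (q j * q (n - j)) = 0.
Proof.
pose c n := \sum_(j < n.+1) (-1) ^+ j * (q j * q (n - j)).
pose d i n := \sum_(j < n.+1) (-1) ^+ j * (theta i (q j) * q (n - j)).
have signB k (j : 'I_k.+1) : (-1) ^+ (k - j) = (-1) ^+ k * (-1) ^+ j :> pseries nat rat.
  by rewrite -signr_odd oddB ?signr_addb ?signr_odd // -ltnS.
have cS k : c k.+1 = q k.+1 - \sum_(j < k.+1) (-1) ^+ j * (q j.+1 * q (k - j)).
  rewrite /c big_ord_recl expr0 !mul1r qrow0 mul1r -sumrN; congr (_ + _).
  by apply: eq_bigr => j _; rewrite lift0 subSS exprS mulN1r mulNr.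
(* In odd degree, reversing the sum changes its sign. *)
have c_odd k : c k.*2.+1 = 0.
  have : c k.*2.+1 = - c k.*2.+1.
    rewrite {1}/c (reindex_inj rev_ord_inj) /= -sumrN; apply: eq_bigr => j _.
    rewrite subSS subKn; last by rewrite -ltnS.
    by rewrite (signB k.*2.+1) -signr_odd /= odd_double expr1 mulN1r mulNr [q _ * q _]mulrC.
  move=> /eqP; rewrite -subr_eq0 opprK -mulr2n -scaler_nat scaler_eq0 pnatr_eq0 /=.
  by move/eqP.
(* In even degree [d i] is half of [theta i] applied to [c], by Leibniz and symmetry. The recurrence
   gives x_i^2 times the previous [d], plus terms without derivatives. *)
have dS i k : d i k.*2 = 0.
  elim: k => [|k IHk].
    by rewrite /d big_ord1 qrow0 theta1 mul0r mulr0.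
  rewrite doubleS /d big_ord_recl big_ord_recl /= qrow0 theta1 mul0r mulr0 add0r.
  rewrite /bump /= !add1n expr1 subSS subn0 theta_qrow1.
  under eq_bigr => j _.
    rewrite /= /bump /= !add1n !subSS theta_qrowSS mulrDl mulrDr !exprS !mulN1r opprK.
    over.
  rewrite big_split /=.
  have -> : \sum_(j < k.*2.+1) (-1) ^+ j *
      (psX rat i * (psX rat i * 1) * theta i (q j) * q (k.*2 - j)) = 0.
    rewrite -[RHS](mulr0 (psX rat i * (psX rat i * 1))) -[in RHS]IHk /d mulr_sumr.
    by apply: eq_bigr => j _; ring.
  (* This turns q_(2k+1) from the term j = 1 into the sum of products that cancels the remaining
     terms. *)
  have /eqP := c_odd k; rewrite cS subr_eq0 => /eqP ->.
  rewrite add0r mulN1r mulr_sumr -sumrN -big_split big1 //= => j _.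
  rewrite -!scalerAl -!scalerAr -scalerN -scalerDr (_ : _ + _ = 0) ?scaler0 //; ring.
move=> n_gt0; rewrite -[LHS]/(c n) -(odd_double_half n).
case: (boolP (odd n)) => [_|ev]; first by rewrite add1n c_odd.
rewrite add0n; have k_gt0 : (0 < n./2)%N by lia.
(* All [theta i] kill [c], so only the constant term is left; it vanishes because each product has a
   factor of positive index. *)
apply/psP => m; have [->|m1] := eqVneq m mone; last first.
  rewrite (@theta_eq0 _ (c _)) // => i; rewrite /c linear_sum /=.
  have signZ j f : theta i ((-1) ^+ j * f) = (-1) ^+ j * theta i f.
    by rewrite -[(-1) ^+ j]signr_odd; case: (odd j); rewrite ?mul1r // !mulN1r linearN.
  under eq_bigr => j _ do rewrite signZ thetaM mulrDr.
  rewrite big_split /= -[X in X + _]/(d i _) dS add0r (reindex_inj rev_ord_inj) /=.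
  rewrite -[RHS](dS i n./2); apply: eq_bigr => j _.
  rewrite subSS subKn; last by rewrite -ltnS.
  by rewrite signB -[_ ^+ _.*2]signr_odd odd_double mul1r [q _ * _]mulrC.
rewrite /c ps_sumE big1 // => j _.
rewrite !psM_mone; have [j0|j_gt0] := posnP j.
  by rewrite [q (_ - _) _]qrow_mone ?mulr0 // j0 subn0 double_gt0.
by rewrite [q j _]qrow_mone // mul0r mulr0.
Qed.

End RowQ.

(** * Algebraic independence of the odd rows *)

Section PolynomialInduction.
Variables (I : choiceType) (R : comNzRingType).

Lemma cmonom_ind (P : {cmonom I} -> Prop) :
  P mone -> (forall i m, P m -> P (mmul (ucm i) m)) -> forall m, P m.
Proof.
move=> P1 PU m; have [n le_mn] := ubnP (mdeg m); elim: n m le_mn => // n IHn m.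
have [->|m1] := eqVneq m mone; first by [].
have [i mi] := cmonom_neq1 m1.
rewrite (mulm_ucm_divcm mi) mdegM mdegU add1n ltnS => le_mn.
exact/PU/IHn.
Qed.

Lemma malgUE (c : R) (m : {cmonom I}) : << c *g m >> = c%:MP * << m >>.
Proof. by rewrite [RHS]malgM_def fgmulUU mulr1 mul1m. Qed.

Lemma malg_ind (P : {malg R[{cmonom I}]} -> Prop) :
  (forall c, P c%:MP) -> (forall p r, P p -> P r -> P (p + r)) ->
  (forall p r, P p -> P r -> P (p * r)) -> (forall i, P << ucm i >>) ->
  forall p, P p.
Proof.
move=> PC PD PM PU p; rewrite [p]monalgE.
apply: (big_ind P) => [|//|m _]; first by rewrite -malgC0E.
rewrite malgUE.
apply: (PM) => //; elim/cmonom_ind: m => [|i m IHm]; first exact: PC.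
rewrite (_ : << _ >> = << ucm i >> * << m >>); first exact: (PM _ _ (PU i) IHm).
by rewrite [RHS]malgM_def fgmulUU mulr1.
Qed.
End PolynomialInduction.

Section PartialDerivative.
Variables (I : choiceType).
Local Notation P := {malg rat[{cmonom I}]}.
Implicit Types (f : P) (m : {cmonom I}).

(** If k does not occur in a monomial, the truncated quotient [divcm] is meaningless but its
    coefficient is zero. *)
Definition pderiv k f : P :=
  \sum_(m <- msupp f) << f@_m *+ m k *g divcm m (ucm k) >>.

Lemma mcoeff_pderiv k f m :
  (pderiv k f)@_m = f@_(mmul (ucm k) m) *+ (m k).+1.
Proof.
rewrite /pderiv raddf_sum /=; pose km := mmul (ucm k) m.
have def_km : divcm km (ucm k) = m by rewrite divcmM.
have kmk : km k = (m k).+1 by rewrite cmM cmUU.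
have out d : d != km -> << f@_d *+ d k *g divcm d (ucm k) >>@_m = 0.
  move=> d_km; rewrite mcoeffU; case: eqP => [def_m|]; last by [].
  have [->|dk] := eqVneq (d k) 0%N; first by rewrite !mulr0n.
  by case/eqP: d_km; rewrite (mulm_ucm_divcm dk) def_m.
have [km_f|km_f] := boolP (km \in msupp f).
  rewrite (big_fsetD1 km) //= big1_fset ?addr0 => [|d /fsetD1P[d_km _] _]; last exact: out.
  by rewrite mcoeffU def_km eqxx kmk.
rewrite (mcoeff_outdom km_f) mul0rn big1_fset // => d d_f _; apply: out.
by apply: contraNneq km_f => <-.
Qed.

Lemma msize_pderiv k f : (msize (pderiv k f) <= (msize f).-1)%N.
Proof.
rewrite msizeE; apply/bigmax_leqP_seq => m; rewrite -mcoeff_neq0 mcoeff_pderiv => f_m _.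
have : mmul (ucm k) m \in msupp f.
  by rewrite -mcoeff_neq0; apply: contraNneq f_m => ->; rewrite mul0rn.
move=> /msize_mdeg_lt; rewrite mdegM mdegU; lia.
Qed.

Lemma pderiv_eq0 f : (forall k, pderiv k f = 0) -> f = (f@_mone)%:MP.
Proof.
move=> f0; apply/malgP => m; rewrite mcoeffC.
have [->|m1] := eqVneq m mone; first by rewrite mulr1n.
have [k mk] := cmonom_neq1 m1; rewrite mulr0n (mulm_ucm_divcm mk).
have := mcoeff_pderiv k f (divcm m (ucm k)); rewrite f0 mcoeff0 => /esym/eqP.
by rewrite mulrn_eq0 => /eqP.
Qed.
End PartialDerivative.

Section ChainRule.
Variables (S : comNzRingType) (D : {additive S -> S}) (v : nat -> S).
Hypothesis D1 : D 1 = 0.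
Hypothesis DM : forall x y, D (x * y) = D x * y + x * D y.

(** The chain rule for a monomial, by Leibniz. The bound [K] gives all monomials of a polynomial one
    common range of summation. *)
Lemma cmeval_deriv K (m : {cmonom nat}) : (forall k, (K <= k)%N -> m k = 0%N) ->
  D (cmeval v m) = \sum_(k < K) (cmeval v (divcm m (ucm (k : nat))) * D (v k)) *+ m k.
Proof.
elim/cmonom_ind: m => [|i m IHm] mK.
  by rewrite mmorph1 D1 big1 // => k _; rewrite cm1.
have {}IHm : D (cmeval v m) =
    \sum_(k < K) (cmeval v (divcm m (ucm (k : nat))) * D (v k)) *+ m k.
  by apply: IHm => k /mK; rewrite cmM => /eqP; rewrite addn_eq0 => /andP[_ /eqP].
have ltiK : (i < K)%N by rewrite ltnNge; apply/negP => /mK; rewrite cmM cmUU.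
under eq_bigr => k _ do rewrite cmM mulrnDr.
rewrite big_split /= (bigD1 (Ordinal ltiK)) //= cmUU mulr1n divcmM big1 => [|k ki]; last first.
  by rewrite cmU eq_sym (negbTE (_ : nat_of_ord k != i)).
rewrite mmorphM /= cmevalU DM addr0 IHm mulr_sumr mulrC; congr (_ + _).
(* Moving x_i inside the quotient by x_k requires that x_k divides [m]. *)
apply: eq_bigr => k _; have [->|mk] := eqVneq (m k) 0%N; first by rewrite !mulr0n mulr0.
rewrite mulrnAr mulrA; congr (_ * _ *+ _); rewrite -{1}(cmevalU v i) -mmorphM.
congr (cmeval v _); apply/eqP/cmP => j; rewrite !(cmM, divcmE, cmU).
by have [<-|_] := eqVneq (k : nat) j; rewrite ?subn0 // addnBA // lt0n.
Qed.
End ChainRule.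

Section OddIndependence.
Local Notation QX := (pseries nat rat).
Local Notation P := {malg rat[{cmonom nat}]}.

(** By [theta_qrow_odd] the Jacobian factors into the Vandermonde-like matrix of the x_i^(2l+1) and
    the unitriangular matrix of the q_(2(k-l)). [G] is [F] after the triangular factor; the two
    factors are cancelled in turn. *)
Lemma jacobian_odd K (F : nat -> QX) :
  (forall i, \sum_(k < K) F k * theta i (qrow k.*2.+1) = 0) ->
  forall k, (k < K)%N -> F k = 0.
Proof.
move=> HF.
pose G l := \sum_(k < K | (l <= k)%N) F k * qrow (k - l).*2.
have HG i : \sum_(l < K) psX rat i ^+ l.*2.+1 * G l = 0.
  have /eqP := HF i.
  have -> : \sum_(k < K) F k * theta i (qrow k.*2.+1)
    = 2 *: \sum_(k < K) \sum_(l < K | (l < k.+1)%N)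
        F k * (psX rat i ^+ l.*2.+1 * qrow (k - l).*2).
    rewrite scaler_sumr; apply: eq_bigr => k _; rewrite theta_qrow_odd -scalerAr; congr (_ *: _).
    rewrite mulr_sumr.
    by rewrite (big_ord_widen K (fun l => F k * (psX rat i ^+ l.*2.+1 * qrow (k - l).*2))).
  rewrite scaler_eq0 pnatr_eq0 /= => /eqP H; rewrite -[RHS]H.
  rewrite (exchange_big_dep predT) //=; apply: eq_bigr => l _.
  by rewrite mulr_sumr; apply: eq_bigr => k _; rewrite mulrCA.
have G0 l : (l < K)%N -> G l = 0.
  (* Compare the coefficients of m x_i^(2l+1) for a variable x_i not in m. *)
  elim/ltn_ind: l => l IHl ltlK; apply/psP => m.
  have [i mi0] : exists i, m i = 0%N.
    exists (\max_(j <- finsupp m) j).+1; apply/eqP; rewrite cmE_eq0; apply/negP => im.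
    by have := @leq_bigmax_seq _ (enum_fset (finsupp m)) xpredT id _ im isT; rewrite ltnn.
  pose mm := iter l.*2.+1 (mmul (ucm i)) m.
  have : (\sum_(l < K) psX rat i ^+ l.*2.+1 * G l) mm = 0 by rewrite HG.
  rewrite -(psXn_mulU i l.*2.+1 (G l) m) -/mm ps_sumE (bigD1 (Ordinal ltlK)) //.
  rewrite big1 => [H|j jl]; first exact: etrans (esym (addr0 _)) H.
  have {}jl : nat_of_ord j != l by exact: jl.
  (* Smaller indices vanish by induction; larger ones carry a power of x_i that does not divide
     [mm]. *)
  have [ltjl|lelj] := ltnP j l.
    by rewrite IHl // mulr0.
  by apply: psXn_mul_lt; rewrite iter_ucmE mi0 addn0 ltnS ltn_double; lia.
(* Back substitution from the largest index, with q_0 = 1 on the diagonal. *)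
move=> k; have [n] := ubnP (K - k)%N; elim: n k => // n IHn k ltn ltkK.
have := G0 k ltkK; rewrite /G (bigD1 (Ordinal ltkK)) //= subnn qrow0 mulr1 big1 ?addr0 //.
move=> j /andP[lekj]; rewrite -val_eqE /= => jk.
by rewrite IHn ?mul0r //; have := ltn_ord j; lia.
Qed.

Definition odd_qeval : P -> QX :=
  mmap (GRing.in_alg QX) (cmeval (fun k => qrow k.*2.+1)).

HB.instance Definition _ := GRing.RMorphism.on odd_qeval.

Lemma theta_odd_qeval f : exists K,
  (forall k, (K <= k)%N -> pderiv k f = 0) /\
  forall i, theta i (odd_qeval f) =
    \sum_(k < K) odd_qeval (pderiv (k : nat) f) * theta i (qrow k.*2.+1).
Proof.
(* One more than the largest variable index occurring in [f]. *)
pose K := (\max_(m <- msupp f) \max_(k <- finsupp m) k).+1.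
have mK m k : m \in msupp f -> (K <= k)%N -> m k = 0%N.
  move=> m_f leKk; apply/eqP; rewrite cmE_eq0; apply/negP => km.
  have le2 := @leq_bigmax_seq _ (enum_fset (msupp f)) xpredT
    (fun m : {cmonom nat} => \max_(k <- finsupp m) k)%N _ m_f isT.
  have le1 := @leq_bigmax_seq _ (enum_fset (finsupp m)) xpredT id _ km isT.
  by have := leq_ltn_trans (leq_trans le1 le2) leKk; rewrite ltnn.
exists K; split=> [k leKk|i].
  by rewrite /pderiv big1_seq // => m /andP[_ /mK->] //; rewrite mulr0n monalgU0.
rewrite {1}/odd_qeval mmapE linear_sum /=.
under [RHS]eq_bigr => k _ do rewrite /pderiv rmorph_sum mulr_suml.
rewrite exchange_big /= big_seq [RHS]big_seq; apply: eq_bigr => m m_f.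
rewrite mulr_algl linearZ /=.
rewrite (@cmeval_deriv _ (theta i) _ (@theta1 _ _ i) (@thetaM _ _ i) K); last first.
  by move=> k; apply: mK.
rewrite scaler_sumr; apply: eq_bigr => k _.
by rewrite /odd_qeval mmapU /= mulr_algl -scalerAl -scalerMnr -scalerMnl.
Qed.

Lemma odd_qeval_inj f : odd_qeval f = 0 -> f = 0.
Proof.
have [n] := ubnP (msize f); elim: n f => // n IHn f le_fn f0.
have [->|fn0] := eqVneq f 0; first by [].
have fk0 k : pderiv k f = 0.
  have [K [KP thK]] := theta_odd_qeval f.
  have [leKk|ltkK] := leqP K k; first exact: KP.
  apply: IHn.
    (* Since [f] is nonzero, [msize f] is positive and its predecessor is strictly smaller. *)
    by have := msize_pderiv k f; move: fn0 le_fn; rewrite -msize_eq0; lia.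
  apply: (@jacobian_odd K (fun k => odd_qeval (pderiv k f))) => // i.
  by rewrite -thK f0 linear0.
rewrite (pderiv_eq0 fk0) in f0 *.
move: f0; rewrite /odd_qeval mmapC /= => /eqP.
by rewrite scaler_eq0 oner_eq0 orbF => /eqP ->; rewrite malgC0E.
Qed.
End OddIndependence.

(** * The ribbon ideal *)

Local Notation QX := (pseries nat rat).
Local Notation P := {malg rat[{cmonom nat}]}.

Section RibLeadingTerm.
Variables (R : comNzRingType) (h : nat -> R) (B : R -> Prop).
Hypothesis BB : forall x y, B x -> B y -> B (x - y).
Hypothesis BM : forall x y, B x -> B y -> B (x * y).

Lemma rib_closed n a s : (forall j, (0 < j < n)%N -> B (h j)) ->
  (0 < a)%N -> all (fun b => 0 < b)%N s -> (a + sumn s < n)%N -> B (rib h a s).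
Proof.
move=> Bh; elim: s a => [|b s IHs] a a0 /= => [_|/andP[b0 s0]] lt_n.
  by apply: Bh; lia.
by apply: BB; [apply: BM; [apply: Bh | apply: IHs] | apply: IHs]; lia.
Qed.

(** Only merging all parts reaches the index [n], at the cost of one sign per merge; every other
    term involves smaller indices. *)
Lemma rib_leading n a s : B 0 -> (forall j, (0 < j < n)%N -> B (h j)) ->
  (0 < a)%N -> all (fun b => 0 < b)%N s -> (a + sumn s = n)%N ->
  B (rib h a s - (-1) ^+ size s * h n).
Proof.
move=> B0 Bh; elim: s a => [|b s IHs] a a0 /= => [_|/andP[b0 s0]] def_n.
  by rewrite -def_n addn0 mul1r subrr.
rewrite exprS mulN1r mulNr opprK -addrA -[X in _ + X]opprK opprD opprK.
apply: (BB); last by apply: IHs => //; lia.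
by apply: (BM); [apply: Bh; lia | apply: (@rib_closed n) => //; lia].
Qed.
End RibLeadingTerm.

Lemma Omega_val_rib a s : Omega_val (rib (fun n => qOmega n%:Z) a s) = rib qrow a s.
Proof.
apply: etrans (rib_morph (\val : {rmorphism Omega -> QX}) _ _ _) _.
by apply: eq_rib => -[|n] //=; rewrite qrow0.
Qed.

Definition ribbon_series (p : Qz) : QX := QOmega_val (ribbon_hom p).

HB.instance Definition _ := GRing.RMorphism.copy ribbon_series
  ((\val : QOmega -> QX) \o ribbon_hom).

Lemma ribbon_seriesB p r : ribbon_series (p - r) = ribbon_series p - ribbon_series r.
Proof. exact: rmorphB. Qed.

Lemma ribbon_seriesD p r : ribbon_series (p + r) = ribbon_series p + ribbon_series r.
Proof. exact: rmorphD. Qed.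

Lemma ribbon_seriesM p r : ribbon_series (p * r) = ribbon_series p * ribbon_series r.
Proof. exact: rmorphM. Qed.

Lemma ribbon_series_zvar a :
  ribbon_series (zvar a) = rib qrow (head 0 a)%N (behead a).
Proof. by rewrite /ribbon_series ribbon_homE /= scale1r ribbonQE Omega_val_rib. Qed.

(** The product relations are [rib_mul]; the even transpose forms vanish by [rib_ones] and
    [qrow_conv]. *)
Lemma ribbon_hom_rel p : ribbon_rel p -> ribbon_hom p = 0.
Proof.
move=> rel_p; apply: val_inj; rewrite -[LHS]/(ribbon_series p).
case: rel_p => [a b|m m_gt0].
  have relE (u v w z : Qz) fu fv fw fz : ribbon_series u = fu -> ribbon_series v = fv ->
      ribbon_series w = fw -> ribbon_series z = fz -> fu * fv = fw + fz ->
      ribbon_series (u * v - w - z) = 0.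
    move=> <- <- <- <-; rewrite !ribbon_seriesB ribbon_seriesM => ->.
    by rewrite addrAC addrK subrr.
  apply: (relE _ _ _ _ _ _ _ _ (ribbon_series_zvar a) (ribbon_series_zvar b)
    (ribbon_series_zvar (comp_dot a b)) (ribbon_series_zvar (comp_odot a b))).
  by case: a b => [[|x s] ?] [[|y t] ?] //; apply: rib_mul.
have relE (u v : Qz) : ribbon_series u = ribbon_series v -> ribbon_series (u - v) = 0.
  by rewrite ribbon_seriesB => ->; rewrite subrr.
apply: relE; apply: etrans (ribbon_series_zvar _) _; apply: etrans (esym (ribbon_series_zvar _)).
have onesE k : (0 < k)%N -> nseq k 1%N = 1%N :: nseq k.-1 1%N by case: k.
rewrite [parts (comp_ones _)](onesE _ m_gt0).
rewrite [behead _]/= [head _ _]/= [RHS]rib_ones ?prednK //; first exact: qrow0.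
exact: qrow_conv.
Qed.

Lemma ribbon_hom_ideal p : p \in ribbon_ideal -> ribbon_hom p = 0.
Proof.
move=> /asboolP[s Gs ->]; rewrite rmorph_sum big1_seq //= => x /Gs /ribbon_hom_rel x0.
by rewrite rmorphM /= x0 mulr0.
Qed.

Lemma ribbon_rel_ideal p : ribbon_rel p -> p \in ribbon_ideal.
Proof.
move=> rel_p; apply/asboolP; exists [:: (1, p)]; last by rewrite big_seq1 mul1r.
by move=> x; rewrite inE => /eqP ->.
Qed.

(** * Reduction to odd rows modulo the ideal *)

Definition zodd (k : nat) : Qz := zvar (comp_row (ltn0Sn k.*2)).

Definition odd_zeval : P -> Qz := mmap (GRing.in_alg Qz) (cmeval zodd).

HB.instance Definition _ := GRing.RMorphism.on odd_zeval.

(** Both sides are algebra homomorphisms sending variable k to q_(2k+1). *)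
Lemma ribbon_series_odd_zeval f : ribbon_series (odd_zeval f) = odd_qeval f.
Proof.
elim/malg_ind: f => [c|f g IHf IHg|f g IHf IHg|k].
- by rewrite /odd_zeval /odd_qeval !mmapC /ribbon_series ribbon_hom_is_scalable rmorph1.
- rewrite (_ : odd_zeval (f + g) = odd_zeval f + odd_zeval g); last exact: rmorphD.
  apply: etrans (ribbon_seriesD _ _) _; apply: etrans (congr2 +%R IHf IHg) _.
  exact/esym/rmorphD.
- rewrite (_ : odd_zeval (f * g) = odd_zeval f * odd_zeval g); last exact: rmorphM.
  apply: etrans (ribbon_seriesM _ _) _; apply: etrans (congr2 *%R IHf IHg) _.
  exact/esym/rmorphM.
by rewrite /odd_zeval /odd_qeval !mmapU /= !cmevalU !scale1r !mul1r ribbon_series_zvar.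
Qed.

Definition odd_reducible (p : Qz) := exists f, p - odd_zeval f \in ribbon_ideal.

Lemma odd_reducible_ideal p r :
  p - r \in ribbon_ideal -> odd_reducible r -> odd_reducible p.
Proof. by move=> pr [f rf]; exists f; rewrite -(subrKA r); exact: rpredD pr rf. Qed.

Lemma odd_reducibleC c : odd_reducible c%:MP.
Proof.
exists c%:MP; rewrite /odd_zeval mmapC /= -mul_malgC mulr1 subrr; exact: rpred0.
Qed.

Lemma odd_reducibleD p r : odd_reducible p -> odd_reducible r -> odd_reducible (p + r).
Proof.
move=> [f pf] [g rg]; exists (f + g); rewrite rmorphD opprD addrACA.
exact: rpredD pf rg.
Qed.

Lemma odd_reducibleM p r : odd_reducible p -> odd_reducible r -> odd_reducible (p * r).
Proof.
move=> [f pf] [g rg]; exists (f * g).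
rewrite rmorphM (_ : _ - _ = r * (p - odd_zeval f) + odd_zeval f * (r - odd_zeval g)).
  exact: rpredD (idealMr _ pf) (idealMr _ rg).
by rewrite !mulrBr [r * p]mulrC [r * _]mulrC subrKA.
Qed.

Lemma odd_reducibleB p r : odd_reducible p -> odd_reducible r -> odd_reducible (p - r).
Proof.
move=> pB rB; apply: odd_reducibleD => //; rewrite -mulN1r.
apply: odd_reducibleM => //; rewrite -[-1](rmorphN1 (@malgC _ _)); exact: odd_reducibleC.
Qed.

(** Made total so that [rib] applies to it; sequences that are not compositions get the default
    z_1. *)
Definition zseq (s : seq nat) : Qz := zvar (insubd (comp_row (ltn0Sn 0)) s).

Lemma zseqE (a : composition) : zvar a = zseq a.
Proof. by rewrite /zseq valKd. Qed.

(** Modulo the ideal, the product relation for a single row and a composition is the recursion of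
    [rib]. *)
Lemma zseq_rib x s : (0 < x)%N -> all (fun b => 0 < b)%N s ->
  zseq (x :: s) - rib (fun n => zseq [:: n]) x s \in ribbon_ideal.
Proof.
elim: s x => [|b t IHt] x x0 /=; first by rewrite subrr rpred0.
move=> /andP[b0 t0].
have bP : is_composition (b :: t) by rewrite /is_composition /= b0.
have rel := ribbon_rel_mul (comp_row x0) (Composition bP).
have {rel} := ribbon_rel_ideal rel; rewrite !zseqE /= => rel.
have I1 := IHt b b0 t0; have I2 := IHt (x + b)%N (ltn_addr _ x0) t0.
set h := (fun n => zseq [:: n]) in I1 I2 *.
have idE (u v w z r1 r2 : Qz) :
  z - (u * r1 - r2) = u * (v - r1) - (w - r2) - (u * v - z - w) by ring.
rewrite (idE _ (zseq (b :: t)) (zseq ((x + b)%N :: t))).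
exact: rpredB (rpredB (idealMr _ I1) I2) rel.
Qed.

Lemma odd_reducible_row n : (0 < n)%N -> odd_reducible (zseq [:: n]).
Proof.
elim/ltn_ind: n => n IHn n0; have [odn|evn] := boolP (odd n).
  exists << ucm n./2 >>; rewrite /odd_zeval mmapU /= cmevalU scale1r mul1r /zodd zseqE /=.
  have -> : (n./2).*2.+1 = n by lia.
  by rewrite subrr rpred0.
have def_n : n = (2 * n./2)%N by lia.
have m0 : (0 < 2 * n./2)%N by rewrite -def_n.
have := ribbon_rel_ideal (ribbon_rel_even m0).
rewrite /xi !zseqE /= -def_n => xiI.
have ones0 : all (fun b => 0 < b)%N (nseq n.-1 1%N) by rewrite all_nseq orbT.
have := zseq_rib (ltn0Sn 0) ones0.
rewrite -[1%N :: _]/(nseq n.-1.+1 1%N) prednK // => ribI.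
set h := (fun n => zseq [:: n]) in ribI.
(* For even [n] the leading term of the column is - z_n, so equating the column with z_n leaves 2
   z_n in terms of smaller rows. *)
have sgn : (-1) ^+ n.-1 = -1 :> Qz.
  by rewrite -signr_odd (_ : odd n.-1 = true) //; lia.
have lead := @rib_leading _ h odd_reducible odd_reducibleB odd_reducibleM n 1 (nseq n.-1 1%N).
rewrite size_nseq sgn mulN1r opprK in lead.
have {lead}twice : odd_reducible (h n + h n).
  apply: (odd_reducible_ideal (r := rib h 1 (nseq n.-1 1%N) + h n)).
    rewrite (_ : _ - _ = (h n - zseq (nseq n 1%N))
        + (zseq (nseq n 1%N) - rib h 1 (nseq n.-1 1%N))).
      exact: rpredD xiI ribI.
    by rewrite [RHS]addrA subrK opprD addrACA subrr addr0.
  apply: lead => //.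
  - by rewrite -malgC0E; exact: odd_reducibleC.
  - by move=> j /andP[j0 ltj]; exact: IHn.
  by rewrite sumn_nseq; lia.
(* Rational coefficients allow the division by 2. *)
have -> : zseq [:: n] = (2^-1)%:MP * (h n + h n).
  by rewrite mul_malgC -mulr2n -scaler_nat scalerA mulVf // scale1r.
exact: odd_reducibleM (odd_reducibleC _) twice.
Qed.

Lemma odd_reducibleT p : odd_reducible p.
Proof.
elim/malg_ind: p => [c|p r|p r|a].
- exact: odd_reducibleC.
- exact: odd_reducibleD.
- exact: odd_reducibleM.
rewrite -/(zvar a) zseqE; case: a => [[|x s] //= /andP[_ /= /andP[x0 s0]]].
apply: (odd_reducible_ideal (zseq_rib x0 s0)).
apply: (@rib_closed _ _ _ odd_reducibleB odd_reducibleM (x + sumn s).+1) => //.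
by move=> j /andP[j0 _]; exact: odd_reducible_row.
Qed.

(** A kernel element is congruent to a polynomial in the odd z, whose image is a relation among the
    odd q and hence trivial. *)
Lemma ribbon_hom_eq0 p : ribbon_hom p = 0 <-> p \in ribbon_ideal.
Proof.
split=> [p0|]; last exact: ribbon_hom_ideal.
have [f pf] := odd_reducibleT p.
have /eqP := ribbon_hom_ideal pf; rewrite rmorphB /= p0 sub0r oppr_eq0 => /eqP f0.
have f_eq0 : f = 0 by apply: odd_qeval_inj; rewrite -ribbon_series_odd_zeval /ribbon_series f0.
by rewrite f_eq0 rmorph0 subr0 in pf.
Qed.

Lemma ribbon_hom_surj w : exists p, ribbon_hom p = w.
Proof.
(* An element of [QOmega] is a single scalar times an element of [Omega], and the generators q_n of
   the latter are images of one-row compositions. *)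
suff Hsurj f : in_Omega f -> exists p, ribbon_series p = f.
  have [[c [f fP]] ->] := tensP w; have [p def_f] := Hsurj f (asboolW fP).
  exists (c *: p); rewrite ribbon_hom_is_scalable; apply: val_inj.
  exact: (congr1 ( *:%R c) def_f).
elim=> [n n0||g h _ [p <-] _ [r <-]|g h _ [p <-] _ [r <-]].
- by exists (zvar (comp_row n0)); rewrite ribbon_series_zvar.
- by exists 1; rewrite rmorph1.
- by exists (p - r); rewrite ribbon_seriesB.
- by exists (p * r); rewrite ribbon_seriesM.
Qed.

Theorem theorem3p9 :
  (exists Phi : {rmorphism {ideal_quot ribbon_ideal} -> QOmega},
     bijective Phi /\
     forall p : Qz, Phi (\pi_({ideal_quot ribbon_ideal}) p) = ribbon_hom p)
  /\ (forall p : Qz, ribbon_hom p = 0 <-> p \in ribbon_ideal).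
Proof.
split; last exact: ribbon_hom_eq0.
pose A := {ideal_quot ribbon_ideal}.
pose phi (x : A) := ribbon_hom (repr x).
(* The ideal lies in the kernel, so the chosen representative does not matter. *)
have phiE p : phi (\pi_A p) = ribbon_hom p.
  apply/eqP; rewrite -subr_eq0 -rmorphB; apply/eqP/ribbon_hom_eq0.
  by rewrite Quotient.idealrBE reprK.
have phi0 : phi 0 = 0 by rewrite -(rmorph0 \pi_A) phiE rmorph0.
have phiD : {morph phi : x y / x + y}.
  by elim/quotW=> p; elim/quotW=> r; rewrite -rmorphD !phiE rmorphD.
have phi1 : phi 1 = 1 by rewrite -(rmorph1 \pi_A) phiE rmorph1.
have phiM : {morph phi : x y / x * y}.
  by elim/quotW=> p; elim/quotW=> r; rewrite -rmorphM !phiE rmorphM.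
pose Phi : {rmorphism A -> QOmega} :=
  HB.pack phi (GRing.isNmodMorphism.Build A QOmega phi (conj phi0 phiD))
    (GRing.isMonoidMorphism.Build A QOmega phi (conj phi1 phiM)).
exists Phi; split=> //.
have [inv invK] := choice ribbon_hom_surj.
(* Two preimages differ by a kernel element, which lies in the ideal, so the class of a chosen
   preimage is a two-sided inverse. *)
exists (fun w => \pi_A (inv w)) => [|w]; last by rewrite [LHS]phiE.
elim/quotW=> p; apply/eqP; rewrite -Quotient.idealrBE.
by apply/ribbon_hom_eq0; rewrite rmorphB /= invK phiE subrr.
Qed.
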